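(* Let $X$ and $Y$ be independent random variables with $0<P\{Y>0\}\le P\{Y\ge0\}=1$, and let $(X_i,Y_i)$, $i\ge1$, be i.i.d. copies of $(X,Y)$. Let $T_n=\sum_{i=1}^nX_iY_i/\sum_{i=1}^nY_i$ (with $0/0:=0$), let $m(n)$ be the smallest $1\le m\le n$ such that $Y_m=\max\{Y_1,\dots,Y_n\}$, and put $$A_n(\varepsilon)=\left\{Y_{m(n)}\Big/\sum_{i=1}^nY_i>1-\varepsilon\right\}\quad(0<\varepsilon<1),\qquad \Delta_n=\left|T_n-X_{m(n)}\right|.$$ Assume that $E|X|<\infty$ and that there exists a subsequence $\{n'\}$ of $\{n\}$ such that $$\lim_{\varepsilon\to0}\liminf_{n'\to\infty}P\{A_{n'}(\varepsilon)\}=:\delta>0.$$ Then $$\lim_{\varepsilon\to0}\liminf_{n'\to\infty}P\{\Delta_{n'}\le\varepsilon\}\ge\delta>0.$$ *)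

(* Defs.v *)
From HB Require Import structures.
From mathcomp Require Import all_boot all_order all_algebra.
From mathcomp Require Import all_classical all_reals all_analysis.

Set Implicit Arguments.
Unset Strict Implicit.
Unset Printing Implicit Defensive.

Import Order.TTheory GRing.Theory Num.Theory.
Import numFieldNormedType.Exports.

Local Open Scope classical_set_scope.
Local Open Scope ring_scope.

Section Independence.
Context {d d1 d2 : measure_display} {T : measurableType d}
  {T1 : measurableType d1} {T2 : measurableType d2} {R : realType}.
Variable P : probability T R.

Definition independent2 (X : T -> T1) (Y : T -> T2) : Prop :=
  forall (A : set T1) (B : set T2), measurable A -> measurable B ->
    P (X @^-1` A `&` Y @^-1` B) = (P (X @^-1` A) * P (Y @^-1` B))%E.

Definition mutually_independent (Z : nat -> T -> T1) : Prop :=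
  forall (J : seq nat) (B : nat -> set T1),
    uniq J -> (forall j, measurable (B j)) ->
    P (\bigcap_(j in [set` J]) (Z j @^-1` B j)) =
    (\prod_(j <- J) P (Z j @^-1` B j))%E.

Definition same_law (Z Z' : T -> T1) : Prop :=
  forall B : set T1, measurable B -> P (Z @^-1` B) = P (Z' @^-1` B).

Definition iid_copies (Z : nat -> T -> T1) (Z0 : T -> T1) : Prop :=
  mutually_independent Z /\ (forall i, same_law (Z i) Z0).

End Independence.

(* The sequences are indexed from 0: [X i] and [Y i] stand for X_(i+1) and
   Y_(i+1), so that the first n terms are those of index i < n.  Since
   0^-1 = 0 in a field, x / 0 = 0; this gives the convention 0/0 := 0. *)
Section Quantities.
Context {T : Type} {R : realType}.
Implicit Types (X Y : nat -> T -> R) (n : nat) (w : T).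

Definition weighted_mean X Y n w : R :=
  (\sum_(i < n) X i w * Y i w) / (\sum_(i < n) Y i w).

(* The maximum of the first n terms for n > 0; for n = 0 it is [Y 0 w]. *)
Definition running_max Y n w : R :=
  \big[Num.max/Y 0%N w]_(i < n) Y i w.

(* [index] returns the first position, hence the smallest maximizer. *)
Definition argmax Y n w : nat :=
  index (running_max Y n w) [seq Y i w | i <- iota 0 n].

Definition dominance_event Y n (eps : R) : set T :=
  [set w | Y (argmax Y n w) w / (\sum_(i < n) Y i w) > 1 - eps].

Definition deviation X Y n w : R :=
  `|weighted_mean X Y n w - X (argmax Y n w) w|.

End Quantities.

(* Main.v *)
Require Import Defs.
From HB Require Import structures.
From mathcomp Require Import all_boot all_order all_algebra.
From mathcomp Require Import all_classical all_reals all_analysis.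
From mathcomp Require Import measurable_realfun.
From mathcomp Require Import lra.
Import Order.TTheory GRing.Theory Num.Theory.
Import numFieldNormedType.Exports.
Local Open Scope classical_set_scope.
Local Open Scope ring_scope.
Local Open Scope ereal_scope.

(** Write [c_i = Y_i / S - [i = m]], with [S] the sum of the [Y_i] and [m] the
    argmax, so that the deviation is [|sum_i X_i c_i|].  On the dominance event
    with the [Y_i] nonnegative, [sum_i |c_i| = 2 (1 - Y_m / S) < 2 eps].  As the
    [c_i] depend only on the [Y_j], which are jointly independent of each [X_i],
    the expectation of [sum_i |X_i| |c_i|] on that event is at most
    [2 eps E|X|], and Markov's inequality gives, uniformly in [n],
      [P (A_n eps) <= P (Delta_n <= eta) + 2 eps E|X| / eta].
    Taking [eps = eta^2] and letting [eta] tend to [0] concludes; the limit in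
    the conclusion exists because [P (Delta_n <= eta)] is monotone in [eta]. *)

(** * Expectation of a product of independent nonnegative factors *)

Lemma ge0_integral_independent2 {d d1 d2 : measure_display}
    {T : measurableType d} {T1 : measurableType d1} {T2 : measurableType d2}
    {R : realType} (P : probability T R) (U : {RV P >-> T1})
    (V : {RV P >-> T2}) (f : T1 -> \bar R) (g : T2 -> \bar R) :
  independent2 P U V ->
  measurable_fun [set: T1] f -> (forall x, 0 <= f x) ->
  measurable_fun [set: T2] g -> (forall y, 0 <= g y) ->
  \int[P]_w (f (U w) * g (V w)) = \int[P]_w f (U w) * \int[P]_w g (V w).
Proof.
move=> UV mf f0 mg g0.
have mUV : measurable_fun [set: T] (fun w => (U w, V w)).
  exact/measurable_fun_pair.
pose UVm : {mfun T >-> (T1 * T2)%type} :=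
  HB.pack (fun w => (U w, V w)) (isMeasurableFun.Build _ _ _ _ _ mUV).
pose h (z : T1 * T2) := f z.1 * g z.2.
have mh : measurable_fun [set: T1 * T2] h.
  by apply: emeasurable_funM; exact: measurableT_comp.
have h0 z : 0 <= h z by exact: mule_ge0.
(* Independence says that the law of [(U, V)] agrees with the product of the two laws on rectangles,
   hence everywhere by uniqueness of the product measure. Tonelli then separates the factors, with
   no integrability condition since [f] and [g] are nonnegative. *)
transitivity (\int[distribution P U \x distribution P V]_z h z).
  rewrite (eq_measure_integral (distribution P UVm)); last first.
    by move=> A mA _; apply: product_measure_unique => // B C mB mC; exact: UV.
  by rewrite ge0_integral_distribution.
rewrite fubini_tonelli1// /fubini_F /h /=.
under eq_integral do rewrite ge0_integralZl//.
rewrite ge0_integralZr//; last exact: integral_ge0.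
by rewrite !ge0_integral_distribution.
Qed.

(** * Independence of each [Xs i] from the whole vector of the [Ys j] *)

Section iid_pairs.
Context {d d1 d2 : measure_display} {T : measurableType d}
  {T1 : measurableType d1} {T2 : measurableType d2} {R : realType}
  {P : probability T R}.
Variables (X : {RV P >-> T1}) (Y : {RV P >-> T2}).
Variables (Xs : nat -> {RV P >-> T1}) (Ys : nat -> {RV P >-> T2}).
Hypothesis XY : independent2 P X Y.
Hypothesis copies : iid_copies P (fun i w => (Xs i w, Ys i w))
                                 (fun w => (X w, Y w)).

Lemma iid_copies_fst i (B : set T1) : measurable B ->
  P (Xs i @^-1` B) = P (X @^-1` B).
Proof.
move=> mB; have := copies.2 i _ (measurableX mB measurableT).
by congr (P _ = P _); apply/seteqP; split => w //= [].
Qed.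

(** Independence between the pairs gives a product over [j]; equality of laws and [XY] split each
    factor in two. Setting some of the sets to [setT] yields the marginal formulas. *)
Lemma iid_copies_bigcap n (B : nat -> set T1) (C : nat -> set T2) :
  (forall j, measurable (B j)) -> (forall j, measurable (C j)) ->
  P (\bigcap_(j in `I_n) (Xs j @^-1` B j `&` Ys j @^-1` C j)) =
  (\prod_(j <- iota 0 n) P (X @^-1` B j)) *
  (\prod_(j <- iota 0 n) P (Y @^-1` C j)).
Proof.
move=> mB mC; have [mi sl] := copies.
have mBC j : measurable (B j `*` C j) by exact: measurableX.
transitivity (P (\bigcap_(j in [set` iota 0 n])
    ((fun w => (Xs j w, Ys j w)) @^-1` (B j `*` C j)))).
  suff -> : `I_n = [set` iota 0 n] by [].
  by apply/seteqP; split=> j /=; rewrite mem_iota.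
rewrite mi ?iota_uniq// -big_split/=; apply: eq_bigr => j _.
by rewrite sl//; exact: XY.
Qed.

Definition sample n (w : T) : n.-tuple T2 := [tuple Ys i w | i < n].

Lemma measurable_sample n : measurable_fun [set: T] (sample n).
Proof.
apply/measurable_fun_tnthP => i.
by apply: eq_measurable_fun (@measurable_funPT _ _ _ _ (Ys i)) => w _ /=;
  rewrite tnth_mktuple.
Qed.

HB.instance Definition _ n :=
  isMeasurableFun.Build _ _ _ _ (sample n) (measurable_sample n).

Let box n (C : nat -> set T2) : set (n.-tuple T2) :=
  [set t | forall i : 'I_n, C i (tnth t i)].

(** These sets form the pi-system on which the two measures of [independent2_sample] are
    compared. *)
Let boxes n : set_system (n.-tuple T2) :=
  [set box n C | C in [set C | forall j, measurable (C j)]].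

Let measurable_boxes n : @measurable _ (n.-tuple T2) = <<s boxes n >>.
Proof.
apply/seteqP; split.
  apply: smallest_sub; first exact: smallest_sigma_algebra.
  rewrite -bigcup_seq => A [/= i _ [B mB <-]].
  apply: sub_sigma_algebra.
  (* A condition on one coordinate is a box whose other sides are [setT]. *)
  exists (fun j => if j == i :> nat then B else setT) => [j|].
    by case: ifP.
  apply/seteqP; split => t /=.
    by move=> /(_ i); rewrite eqxx.
  by move=> [_ Bt] j; case: ifPn => // /eqP/val_inj ->.
apply: smallest_sub; first exact: sigma_algebra_measurable.
move=> _ [C mC <-].
have -> : box n C = \bigcap_(i in [set: 'I_n]) ((@tnth _ _)^~ i @^-1` C i).
  by apply/seteqP; split => t /= h i; [move=> _; exact: h|exact: h].
apply: fin_bigcap_measurable => // i _.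
by rewrite -[X in measurable X]setTI; exact: measurable_tnth.
Qed.

Lemma independent2_sample n i : (i < n)%N -> independent2 P (Xs i) (sample n).
Proof.
move=> ltin A B mA mB.
have mXA : measurable (Xs i @^-1` A).
  by rewrite -[X in measurable X]setTI; exact: measurable_funPT.
have @m1 : {measure set (n.-tuple T2) -> \bar R}.
  unshelve refine
    (pushforward (mrestr P mXA) (sample n) : {measure set _ -> \bar R}).
  exact: measurable_sample.
pose p := NngNum (fine_ge0 (measure_ge0 P (Xs i @^-1` A))).
pose m2 := mscale p (distribution P (sample n)).
have pE : (p%:num)%:E = P (Xs i @^-1` A) by rewrite /= fineK// fin_num_measure.
have boxesI : setI_closed (boxes n).
  move=> _ _ [C mC <-] [D mD <-]; exists (fun j => C j `&` D j).
    by move=> j; exact: measurableI.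
  apply/seteqP; split => t /=; last by move=> [h k] j.
  by move=> h; split => j; case: (h j).
have m12 C : boxes n C -> m1 C = m2 C.
  move=> {C} [C mC <-].
  rewrite /m1 /m2 /mscale /= /distribution /pushforward /mrestr pE.
  have boxE : sample n @^-1` box n C = \bigcap_(j in `I_n) (Ys j @^-1` C j).
    apply/seteqP; split => w /= h j.
      by move=> jn; have := h (Ordinal jn); rewrite tnth_mktuple.
    by rewrite tnth_mktuple; apply: h => /=.
  (* The constraint on [Xs i] alone becomes a family of constraints, trivial for [j] other than [i],
     so that [iid_copies_bigcap] applies. *)
  have -> : sample n @^-1` box n C `&` Xs i @^-1` A =
      \bigcap_(j in `I_n)
        (Xs j @^-1` (if j == i then A else setT) `&` Ys j @^-1` C j).
    rewrite boxE; apply/seteqP; split => w /=.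
      by move=> [h Aw] j jn; split; [case: eqP => [->|]|exact: h].
    move=> h; split=> [j jn|]; first by have [] := h _ jn.
    by have [] := h _ ltin; rewrite eqxx.
  rewrite (@iid_copies_bigcap n (fun j => if j == i then A else setT) C)//.
    2: by move=> j; case: ifP.
  have -> : sample n @^-1` box n C =
      \bigcap_(j in `I_n) (Xs j @^-1` setT `&` Ys j @^-1` C j).
    by rewrite boxE; apply: eq_bigcapr => j _; rewrite preimage_setT setTI.
  rewrite (@iid_copies_bigcap n (fun=> setT) C)//.
  rewrite [X in _ = _ * (X * _)]big1 ?mul1e//; last first.
    by move=> j _; rewrite preimage_setT probability_setT.
  congr *%E; rewrite iid_copies_fst//.
  have in_n : i \in iota 0 n by rewrite mem_iota.
  rewrite (bigD1_seq i)//= ?iota_uniq// eqxx big1 ?mule1// => j /negPf ->.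
  by rewrite preimage_setT probability_setT.
have : m1 B = m2 B.
  apply: (measure_unique (boxes n) (fun=> setT)) => //.
  - exact: measurable_boxes.
  - by move=> _; exists (fun=> setT) => //; apply/seteqP; split.
  - by rewrite bigcup_const.
  - move=> _; rewrite /= /pushforward /mrestr preimage_setT setTI.
    by rewrite (le_lt_trans (probability_le1 _ _)) ?ltry.
by rewrite /m1 /m2 /mscale /= /distribution /pushforward /mrestr pE setIC.
Qed.

End iid_pairs.

(** * Pointwise algebra of the deviation and of its weights *)

Section dominance.
Context {T : Type} {R : realType}.
Implicit Types (X Y : nat -> T -> R) (n i : nat) (w : T).
Local Open Scope ring_scope.

Lemma running_max_mem Y n w : (0 < n)%N ->
  running_max Y n w \in [seq Y i w | i <- iota 0 n].
Proof.
move=> n0; rewrite /running_max -(big_mkord xpredT (fun i => Y i w)).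
rewrite /index_iota subn0.
have Y0 : Y 0%N w \in [seq Y i w | i <- iota 0 n].
  by apply: map_f; rewrite mem_iota.
(* The induction has to admit the starting value [Y 0 w] as a possible maximum; for [n > 0] it is
   one of the terms. *)
suff : forall s, \big[Num.max/Y 0%N w]_(i <- s) Y i w \in
    Y 0%N w :: [seq Y i w | i <- s].
  by move=> /(_ (iota 0 n)); rewrite inE => /predU1P[->|].
elim=> [|i s ih]; first by rewrite big_nil mem_head.
rewrite big_cons /Num.max; case: ifP => _; last by rewrite !inE eqxx orbT.
by move: ih; rewrite !inE => /orP[->|->]; rewrite ?orbT.
Qed.

Lemma argmax_lt Y n w : (0 < n)%N -> (argmax Y n w < n)%N.
Proof.
by move=> /(running_max_mem Y n w); rewrite -index_mem size_map size_iota.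
Qed.

(** The coefficient [c_i] of [X i w] in the signed deviation. It involves [Y] only. *)
Definition excess_weight Y n i w : R :=
  Y i w / (\sum_(j < n) Y j w) - (argmax Y n w == i)%:R.

Lemma deviationE X Y n w : (0 < n)%N ->
  deviation X Y n w = `|\sum_(i < n) X i w * excess_weight Y n i w|.
Proof.
move=> n0; rewrite /deviation /weighted_mean /excess_weight; congr `| _ |.
under [in RHS]eq_bigr do rewrite mulrBr mulrA.
rewrite sumrB -mulr_suml; congr (_ - _).
rewrite (bigD1 (Ordinal (argmax_lt Y n w n0)))//= eqxx mulr1 big1 ?addr0// => i.
by rewrite -val_eqE/= eq_sym => /negPf ->; rewrite mulr0.
Qed.

Lemma sum_norm_excess_weight Y n w (eps : R) : (0 < n)%N -> eps < 1 ->
  (forall i : 'I_n, 0 <= Y i w) -> dominance_event Y n eps w ->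
  \sum_(i < n) `|excess_weight Y n i w| <= 2 * eps.
Proof.
move=> n0 eps1 Y0; rewrite /dominance_event/=.
set m := argmax Y n w; set S := \sum_(i < n) Y i w => Am.
have mn : (m < n)%N by exact: argmax_lt.
(* If [S = 0], the quotient in the event is [0] by convention, which does not exceed [1 - eps] as
   [eps < 1]. *)
have S0 : S != 0.
  by apply/negP => /eqP S0; move: Am; rewrite S0 invr0 mulr0; lra.
have Sge0 : 0 <= S by exact: sumr_ge0.
have sum1 : \sum_(i < n) Y i w / S = 1 by rewrite -mulr_suml divff.
(* The terms other than [m] are nonnegative and add up to [1 - Y m w / S]; the term at [m] has this
   same absolute value, whence the factor 2. *)
move: sum1; rewrite (bigD1 (Ordinal mn))//= => sum1.
rewrite (bigD1 (Ordinal mn))//= /excess_weight -/S.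
rewrite (eq_bigr (fun i : 'I_n => Y i w / S)); last first.
  move=> i; rewrite -val_eqE/= eq_sym -/m => /negPf ->.
  by rewrite subr0 ger0_norm// divr_ge0.
rewrite -/m eqxx mulr1n.
rewrite ler0_norm; first lra.
rewrite subr_le0 -[leRHS]sum1 lerDl sumr_ge0// => i _.
by rewrite divr_ge0.
Qed.

End dominance.

(** * Transfer between sample spaces *)

Section dominance_eq.
Context {T T' : Type} {R : realType}.
Variables (Y : nat -> T -> R) (Y' : nat -> T' -> R) (n : nat) (w : T) (w' : T').
Hypotheses (n0 : (0 < n)%N) (YY' : forall i, (i < n)%N -> Y i w = Y' i w').

(** The domains [T] and [T'] may differ: this serves to pass from [Ys] on the probability space to
    the coordinates on the space of tuples. *)
Lemma eq_argmax : argmax Y n w = argmax Y' n w'.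
Proof.
rewrite /argmax /running_max YY'//.
congr index; first by apply: eq_bigr => i _; rewrite YY'.
by apply/eq_in_map => i; rewrite mem_iota => /YY'.
Qed.

Let eq_sum : (\sum_(i < n) Y i w = \sum_(i < n) Y' i w')%R.
Proof. by apply: eq_bigr => i _; rewrite YY'. Qed.

Lemma eq_excess_weight i : (i < n)%N ->
  excess_weight Y n i w = excess_weight Y' n i w'.
Proof. by move=> /YY' Yi; rewrite /excess_weight eq_argmax eq_sum Yi. Qed.

Lemma eq_dominance_event (eps : R) :
  dominance_event Y n eps w <-> dominance_event Y' n eps w'.
Proof.
by rewrite /dominance_event/= eq_argmax eq_sum YY'// argmax_lt.
Qed.

End dominance_eq.

(* [x^-1 = x * (x ^+ 2) `^ (-1)], also at [x = 0], where both sides are [0]. *)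
Lemma measurable_invr {R : realType} :
  measurable_fun [set: R] (fun x : R => x^-1)%R.
Proof.
have := measurable_funM (@measurable_id _ R setT)
  (measurableT_comp (measurable_powR (-1)%R) (@exprn_measurable R setT 2)).
apply: eq_measurable_fun => x _ /=.
rewrite powR_inv1 ?sqr_ge0// expr2.
have [->|x0] := eqVneq x 0%R; first by rewrite mul0r invr0.
by rewrite invfM mulrA divff// mul1r.
Qed.

(** * Measurability of the argmax, the weights and the events *)

Section dominance_measurable.
Context {d : measure_display} {T : measurableType d} {R : realType}.
Variables (Y : nat -> T -> R).
Hypothesis mY : forall i, measurable_fun [set: T] (Y i).

Lemma measurable_running_max n : measurable_fun [set: T] (running_max Y n).
Proof.
rewrite /running_max; elim: (index_enum _) => [|i s ih].
  by under eq_fun do rewrite big_nil; exact: mY.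
by under eq_fun do rewrite big_cons; exact: measurable_maxr.
Qed.

Lemma measurable_argmax n : measurable_fun [set: T] (argmax Y n).
Proof.
(* Only the list that is searched shrinks, the maximum staying fixed: [index] on a cons is a test
   followed by [0] or a successor. *)
rewrite /argmax; elim: (iota 0 n) => [|i s ih]/=; first exact: measurable_cst.
apply: measurable_fun_ifT => //.
  by apply: measurable_fun_eqr => //; exact: measurable_running_max.
have mS : measurable_fun [set: nat] succn by [].
exact: (measurableT_comp mS ih).
Qed.

Lemma measurable_comp_argmax n (X : nat -> T -> R) :
  (forall i, measurable_fun [set: T] (X i)) ->
  measurable_fun [set: T] (fun w => X (argmax Y n w) w).
Proof.
move=> mX _ B mB; rewrite setTI.
(* The random index takes countably many values, so the preimage is split according to its value
   [k]. *)
rewrite (_ : _ @^-1` _ =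
    \bigcup_k (argmax Y n @^-1` [set k] `&` X k @^-1` B)); last first.
  apply/seteqP; split => [w Bw|w [k _ [/= <-]]]//.
  by exists (argmax Y n w).
apply: bigcup_measurable => k _; apply: measurableI.
  by rewrite -[X in measurable X]setTI; exact: measurable_argmax.
by rewrite -[X in measurable X]setTI; exact: mX.
Qed.

Lemma measurable_partial_sum n :
  measurable_fun [set: T] (fun w => \sum_(i < n) Y i w)%R.
Proof. by apply: measurable_sum => i. Qed.

Lemma measurable_excess_weight n i :
  measurable_fun [set: T] (excess_weight Y n i).
Proof.
apply: measurable_funB.
  apply: measurable_funM => //; apply: measurableT_comp => //.
    exact: measurable_invr.
  exact: measurable_partial_sum.
have mb : measurable_fun [set: bool] (fun b : bool => b%:R : R) by [].
apply: (measurableT_comp mb).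
apply: measurable_fun_eqn => //; exact: measurable_argmax.
Qed.

Lemma measurable_dominance_event n (eps : R) :
  measurable (dominance_event Y n eps).
Proof.
rewrite -[X in measurable X]setTI.
apply: (measurable_fun_ltr (f := cst (1 - eps)%R)) => //.
apply: measurable_funM; first exact: measurable_comp_argmax.
apply: measurableT_comp => //; first exact: measurable_invr.
exact: measurable_partial_sum.
Qed.

Lemma measurable_deviation n (X : nat -> T -> R) :
  (forall i, measurable_fun [set: T] (X i)) ->
  measurable_fun [set: T] (deviation X Y n).
Proof.
move=> mX; apply: measurableT_comp => //; apply: measurable_funB.
  apply: measurable_funM.
    by apply: measurable_sum => i; exact: measurable_funM.
  apply: measurableT_comp => //; first exact: measurable_invr.
  exact: measurable_partial_sum.
exact: measurable_comp_argmax.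
Qed.

Lemma measurable_deviation_le n (X : nat -> T -> R) (eps : R) :
  (forall i, measurable_fun [set: T] (X i)) ->
  measurable [set w | (deviation X Y n w <= eps)%R].
Proof.
move=> mX; rewrite -[X in measurable X]setTI.
apply: (measurable_fun_ler (g := cst eps)) => //.
exact: measurable_deviation.
Qed.

End dominance_measurable.

(** * The bound on the dominance probability, uniform in [n] *)

Section deviation_bound.
Context {d : measure_display} {T : measurableType d} {R : realType}
  {P : probability T R}.
Variables (X Y : {RV P >-> R}) (Xs Ys : nat -> {RV P >-> R}).
Hypothesis XY : independent2 P X Y.
Hypothesis Y_ge0 : P [set w | (0 <= Y w)%R] = 1.
Hypothesis copies : iid_copies P (fun i w => (Xs i w, Ys i w))
                                 (fun w => (X w, Y w)).

Lemma integral_norm_copy i :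
  \int[P]_w `|Xs i w|%:E = 'E_P[fun w => `|X w|%R].
Proof.
rewrite unlock.
have mnorm : measurable_fun [set: R] (fun x : R => `|x|%:E).
  by apply/measurable_EFinP; exact: normr_measurable.
rewrite -(ge0_integral_distribution (Xs i) mnorm)//.
rewrite -(ge0_integral_distribution X mnorm)//.
by apply: eq_measure_integral => B mB _; exact: (iid_copies_fst _ _ _ _ copies).
Qed.

Lemma measurable_copies_ge0 n :
  measurable (\bigcap_(i in `I_n) [set w | (0 <= Ys i w)%R]).
Proof.
apply: bigcap_measurableType => i _.
rewrite -[X in measurable X]setTI.
exact: (measurable_fun_ler (f := cst 0%R)).
Qed.

Lemma copies_ge0 n : P (\bigcap_(i in `I_n) [set w | (0 <= Ys i w)%R]) = 1.
Proof.
have := iid_copies_bigcap _ _ _ _ XY copies n _ _ (fun=> measurableT)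
  (fun=> measurable_itv `[0%R, +oo[).
rewrite !big1; first last.
- by move=> i _; rewrite preimage_setT probability_setT.
- move=> i _; rewrite -[RHS]Y_ge0; congr (P _).
  by apply/seteqP; split => w /=; rewrite in_itv/= andbT.
rewrite mule1 => <-; congr (P _); apply: eq_bigcapr => i _.
by rewrite preimage_setT setTI; apply/seteqP; split => w /=;
  rewrite in_itv/= andbT.
Qed.

(** The default [0] turns a tuple into a sequence indexed by [nat], as the quantities on sequences
    require; the values beyond [n] do not affect them when [n > 0]. *)
Let coord n (i : nat) (t : n.-tuple R) : R := nth 0%R t i.

Let measurable_coord n i : measurable_fun [set: n.-tuple R] (coord n i).
Proof.
rewrite /coord; have [ni|ni] := ltnP i n; last first.
  have -> : (fun t : n.-tuple R => t`_i)%R = cst 0%R.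
    by apply/funext => t; rewrite nth_default// size_tuple.
  exact: measurable_cst.
apply: eq_measurable_fun (measurable_tnth (Ordinal ni)) => t _.
by rewrite (tnth_nth 0%R).
Qed.

Let coord_sample n w i : (i < n)%N -> Ys i w = coord n i (sample Ys n w).
Proof.
by move=> ni; rewrite /coord -(tnth_nth 0%R _ (Ordinal ni)) tnth_mktuple.
Qed.

(** Nonnegativity is built in, so that the bound on the weights holds at every tuple and not just
    almost surely. *)
Let good n eps : set (n.-tuple R) := dominance_event (coord n) n eps `&`
  \bigcap_(i in `I_n) [set t | (0 <= coord n i t)%R].

Let measurable_good n eps : measurable (good n eps).
Proof.
apply: measurableI.
  exact: measurable_dominance_event (measurable_coord n) _ _.
apply: bigcap_measurableType => i _.
rewrite -[X in measurable X]setTI.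
apply: (measurable_fun_ler (f := cst 0%R)) => //; exact: measurable_coord.
Qed.

Let weight n eps i (t : n.-tuple R) : R :=
  (\1_(good n eps) t * `|excess_weight (coord n) n i t|)%R.

Let measurable_weight n eps i :
  measurable_fun [set: n.-tuple R] (weight n eps i).
Proof.
apply: measurable_funM; first exact: (measurable_indic (measurable_good n eps)).
apply: measurableT_comp => //.
exact: measurable_excess_weight (measurable_coord n) _ _.
Qed.

Let weight_ge0 n eps i t : (0 <= weight n eps i t)%R.
Proof. by rewrite mulr_ge0. Qed.

Let sum_weight n eps t : (0 < n)%N -> (0 < eps < 1)%R ->
  (\sum_(i < n) weight n eps i t <= 2 * eps)%R.
Proof.
move=> n0 /andP[eps0 eps1]; rewrite /weight -mulr_sumr indicE.
have [|] := boolP (t \in good n eps); last by rewrite mul0r; lra.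
rewrite inE mul1r => -[domt ge0t]; apply: sum_norm_excess_weight => // i.
exact: (ge0t i (ltn_ord i)).
Qed.

Lemma dominance_le_deviation n (eps eta : R) :
  (0 < eps < 1)%R -> (0 < eta)%R ->
  P (dominance_event Ys n eps) <=
  P [set w | (deviation Xs Ys n w <= eta)%R] +
  (2 * eps / eta)%:E * 'E_P[fun w => `|X w|%R].
Proof.
move=> /andP[eps0 eps1] eta0.
have EX0 : 0 <= 'E_P[fun w => `|X w|%R] by exact: expectation_ge0.
have c0 : (0 <= 2 * eps / eta)%R by rewrite divr_ge0 ?mulr_ge0// ltW.
(* For [n = 0] the denominator is [0], so the quotient is [0] and the dominance event is empty. *)
have [n0|n0] := posnP n.
  rewrite (_ : dominance_event _ _ _ = set0).
    by rewrite measure0 adde_ge0// mule_ge0.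
  apply/seteqP; split => // w.
  by rewrite /dominance_event/= n0 big_ord0 invr0 mulr0; lra.
(* [Z] bounds the deviation on the good event, and each of its terms is a product of independent
   factors. *)
pose Z w := (\sum_(i < n) `|Xs i w| * weight n eps i (sample Ys n w))%R.
have mWi (i : 'I_n) :
    measurable_fun [set: T] (fun w => weight n eps i (sample Ys n w)).
  exact: (measurableT_comp (measurable_weight _ _ _) (measurable_sample Ys n)).
have mZi (i : 'I_n) :
    measurable_fun [set: T]
      (fun w => `|Xs i w| * weight n eps i (sample Ys n w))%R.
  by apply: measurable_funM => //; exact: measurableT_comp.
have mZ : measurable_fun [set: T] Z by exact: measurable_sum.
have Z0 w : (0 <= Z w)%R by apply: sumr_ge0 => i _; rewrite mulr_ge0.
have EZ : \int[P]_w (Z w)%:E <= (2 * eps)%:E * 'E_P[fun w => `|X w|%R].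
  under eq_integral do rewrite /Z -sumEFin.
  rewrite ge0_integral_sum//; last 2 first.
  - move=> i; apply/measurable_EFinP; exact: mZi.
  - by move=> i w _; rewrite lee_fin mulr_ge0.
  have EXi (i : 'I_n) :
      \int[P]_w (`|Xs i w| * weight n eps i (sample Ys n w))%:E =
      'E_P[fun w => `|X w|%R] * \int[P]_w (weight n eps i (sample Ys n w))%:E.
    under eq_integral do rewrite EFinM.
    rewrite (@ge0_integral_independent2 _ _ _ _ _ _ _ P (Xs i) (sample Ys n)
      (fun x => `|x|%:E) (fun t => (weight n eps i t)%:E))//.
    - by rewrite integral_norm_copy.
    - exact: independent2_sample _ _ _ _ XY copies _ _ (ltn_ord i).
    - by apply/measurable_EFinP; exact: normr_measurable.
    - by apply/measurable_EFinP; exact: measurable_weight.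
    - by move=> t; rewrite lee_fin.
  (* The factor [E|X|], common to all [i], leaves the sum; the weights are then summed again under
     the integral, where [sum_weight] bounds them pointwise by [2 * eps], whatever [n] is. *)
  rewrite (eq_bigr _ (fun i _ => EXi i)) -ge0_sume_distrr; last first.
    by move=> i _; apply: integral_ge0 => w _; rewrite lee_fin.
  rewrite -ge0_integral_sum//; last 2 first.
  - move=> i; apply/measurable_EFinP; exact: mWi.
  - by move=> i w _; rewrite lee_fin.
  rewrite muleC; apply: lee_wpmul2r => //.
  apply: (@le_trans _ _ (\int[P]_w (2 * eps)%:E)); last first.
    by rewrite integral_cst//= probability_setT mule1.
  apply: ge0_le_integral => //.
  - by move=> w _; apply: sume_ge0 => i _; rewrite lee_fin.
  - by apply: emeasurable_sum => i; apply/measurable_EFinP; exact: mWi.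
  - by move=> w _; rewrite sumEFin lee_fin sum_weight// eps0.
have markovZ : P [set w | (eta <= Z w)%R] <=
    (2 * eps / eta)%:E * 'E_P[fun w => `|X w|%R].
  pose Zm : {RV P >-> R} := HB.pack Z (isMeasurableFun.Build _ _ _ _ _ mZ).
  have := @markov _ _ _ P Zm id eta eta0 (@measurable_id _ _ _) (fun _ h => h)
    (fun _ _ _ _ h => h).
  have -> : 'E_P[id \o (fun x : R => `|x|%R) \o Zm] = \int[P]_w (Z w)%:E.
    by rewrite unlock; apply: eq_integral => w _ /=; rewrite ger0_norm.
  have -> : [set w | eta%:E <= `|(Zm w)%:E|] = [set w | (eta <= Z w)%R].
    by apply/seteqP; split => w /=; rewrite ger0_norm// lee_fin.
  move=> /le_trans/(_ EZ); rewrite -lee_pdivlMl//.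
  by rewrite muleA -EFinM mulrC.
pose N := \bigcap_(i in `I_n) [set w | (0 <= Ys i w)%R].
have PN0 : P (~` N) = 0.
  rewrite probability_setC ?copies_ge0 ?subee//.
  exact: measurable_copies_ge0.
pose D := [set w | (deviation Xs Ys n w <= eta)%R].
have mD : measurable D by exact: measurable_deviation_le.
have mZe : measurable [set w | (eta <= Z w)%R].
  rewrite -[X in measurable X]setTI.
  exact: (measurable_fun_ler (f := cst eta)).
have sub : dominance_event Ys n eps `<=`
    ~` N `|` (D `|` [set w | (eta <= Z w)%R]).
  move=> w Aw.
  have [Nw|] := pselect (N w); last by left.
  right; have [|dev] := leP (deviation Xs Ys n w) eta; first by left.
  right => /=; apply: (le_trans (ltW dev)).
  rewrite deviationE// (le_trans (ler_norm_sum _ _ _))// ler_sum// => i _.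
  rewrite normrM /weight (eq_excess_weight _ _ _ _ _ n0 (@coord_sample n w))//.
  rewrite indicE mem_set ?mul1r//; split.
    have domE := eq_dominance_event Ys _ _ w _ n0 (@coord_sample n w) eps.
    exact: (iffLR domE Aw).
  by move=> j jn /=; rewrite -coord_sample//; exact: Nw.
have mN : measurable (~` N).
  by apply: measurableC; exact: measurable_copies_ge0.
apply: (@le_trans _ _ (P (~` N `|` (D `|` [set w | (eta <= Z w)%R])))).
  apply: le_measure; rewrite ?inE//.
    exact: measurable_dominance_event.
  by do ![apply: measurableU => //].
apply: (le_trans (measureU2 _ _ _)) => //; first exact: measurableU.
rewrite [X in X + _]PN0 add0e.
by apply: (le_trans (measureU2 _ _ _)) => //; rewrite leeD2l.
Qed.

End deviation_bound.

(** * Passage to the limit *)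

Lemma le_limn_einf {R : realType} (u v : (\bar R)^nat) :
  (forall n, u n <= v n) -> limn_einf u <= limn_einf v.
Proof.
move=> uv; rewrite !limn_einf_lim; apply: lee_lim; [exact: is_cvg_einfs..|].
apply: nearW => n; apply: le_ereal_inf_tmp => _ [m /= nm <-].
by apply: ge_ereal_inf; exists (u m) => //; exists m.
Qed.

Lemma cvg_sqr_at_right0 {R : realType} :
  (x ^+ 2)%R @[x --> (0%R : R)^'+] `=>` (0%R : R)^'+.
Proof.
(* With radius at most 1, [x ^+ 2 <= x < e]. *)
move=> A [e /= e0 Ae]; exists (Num.min 1 e)%R; first by rewrite /= lt_min ltr01.
move=> x /=; rewrite sub0r normrN lt_min => /andP[x1 xe] x0.
apply: Ae => /=; last exact: exprn_gt0.
rewrite sub0r normrN normrX (le_lt_trans _ xe)// expr2.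
by rewrite ler_piMl// ltW.
Qed.

Theorem theorem4 (d : measure_display) (T : measurableType d) (R : realType)
    (P : probability T R)
    (X Y : {RV P >-> R}) (Xs Ys : nat -> {RV P >-> R})
    (indepXY : independent2 P X Y)
    (Ypos : 0 < P [set w | (0 < Y w)%R])
    (Yle : P [set w | (0 < Y w)%R] <= P [set w | (0 <= Y w)%R])
    (Ynneg : P [set w | (0 <= Y w)%R] = 1)
    (copies : iid_copies P (fun i w => (Xs i w, Ys i w))
                           (fun w => (X w, Y w)))
    (EX : 'E_P[fun w => `|X w|%R] < +oo)
    (n' : nat -> nat) (n'_incr : {homo n' : i j / (i < j)%N})
    (delta : \bar R)
    (limA : limn_einf (fun k => P (dominance_event Ys (n' k) eps))
              @[eps --> (0%R : R)^'+] --> delta)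
    (delta_gt0 : 0 < delta) :
  exists l : \bar R,
    limn_einf (fun k => P [set w | (deviation Xs Ys (n' k) w <= eps)%R])
      @[eps --> (0%R : R)^'+] --> l
    /\ 0 < delta <= l.
Proof.
pose F (eta : R) :=
  limn_einf (fun k => P [set w | (deviation Xs Ys (n' k) w <= eta)%R]).
have ndF : {homo F : x y / (x <= y)%R >-> x <= y}.
  move=> x y xy; apply: le_limn_einf => k; apply: le_measure; rewrite ?inE.
  - exact: measurable_deviation_le.
  - exact: measurable_deviation_le.
  - by move=> w /= /le_trans; apply.
(* Monotonicity of [F] gives its right limit at [0] as an infimum, which is the witness [l]. *)
have := @nondecreasing_at_right_cvge _ F 0%R (BInfty R false) isT (in2W ndF).
set l := ereal_inf _ => cvgF.
exists l; split => //; rewrite delta_gt0/=.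
have EX0 : 0 <= 'E_P[fun w => `|X w|%R] by exact: expectation_ge0.
have [c cE] : exists c, 'E_P[fun w => `|X w|%R] = c%:E.
  by exists (fine 'E_P[fun w => `|X w|%R]); rewrite fineK// ge0_fin_numE.
(* Substituting [eps = eta ^+ 2] turns the error [2 * eps / eta * c] into [2 * eta * c], which tends
   to [0]. *)
have cvgA := cvg_comp _ _ cvg_sqr_at_right0 limA.
have cvg_err : (2 * eta * c)%R @[eta --> (0%R : R)^'+] --> (2 * 0 * c)%R.
  apply: cvg_at_right_filter; apply: cvgM; last exact: cvg_cst.
  by apply: cvgM; [exact: cvg_cst|exact: cvg_id].
rewrite mulr0 mul0r in cvg_err.
have cvgG : (2 * eta * c)%:E + F eta @[eta --> (0%R : R)^'+] --> 0 + l.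
  by apply: cvgeD => //; apply: cvg_EFin => //; exact: nearW.
rewrite -[l]add0e -(cvg_lim _ cvgA)// -(cvg_lim _ cvgG)//.
apply: lee_lim; [exact: cvgP cvgA|exact: cvgP cvgG|].
near=> eta.
have eta0 : (0 < eta)%R by near: eta; exact: nbhs_right_gt.
have eta1 : (eta < 1)%R by near: eta; exact: nbhs_right_lt.
(* The error does not depend on [k], so it moves inside the limit inferior and a termwise comparison
   suffices. *)
rewrite /= -limn_einf_shift//; apply: le_limn_einf => k.
rewrite addeC.
have e01 : (0 < eta ^+ 2 < 1)%R by rewrite exprn_gt0//= expr_lt1// ltW.
have := dominance_le_deviation _ _ _ _ indepXY Ynneg copies (n' k) _ _ e01 eta0.
by rewrite cE -EFinM expr2 !mulrA mulfK// gt_eqF.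
Unshelve. all: by end_near.
Qed.
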